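(* Let $\mathfrak R$ be a topologically semiperfect topological ring. Then the following properties hold: (a) the topological Jacobson radical $\mathfrak H=\mathfrak H(\mathfrak R)$ is strongly closed in $\mathfrak R$; (b) the topological quotient ring $\mathfrak R/\mathfrak H$ is topologically semisimple.
   Context: All rings are associative and unital. All topological rings are complete, separated and right linear: open right ideals $\mathfrak I$ form a base of neighborhoods of zero and $\mathfrak R\to\varprojlim_{\mathfrak I}\mathfrak R/\mathfrak I$ is bijective. A family $(r_x)_{x\in X}$ in a topological abelian group with linear topology is zero-convergent if every open subgroup contains $r_x$ for all but finitely many $x$; infinite sums of zero-convergent families are limits of finite partial sums. A nonzero ring is local if its noninvertible elements form an additive subgroup. $\mathfrak R$ is topologically semiperfect if there exist a set $Z$ and a zero-convergent family $(e_z)_{z\in Z}$ of pairwise orthogonal idempotents in $\mathfrak R$ with $\sum_{z\in Z}e_z=1$ such that every ring $e_z\mathfrak R e_z$ is local. The topological Jacobson radical $\mathfrak H(\mathfrak R)$ is the intersection of all open maximal right ideals of $\mathfrak R$; it is a closed two-sided ideal. A closed subgroup $\mathfrak H$ of a complete separated topological abelian group $\mathfrak A$ (with linear topology) is strongly closed if the quotient group $\mathfrak A/\mathfrak H$ is complete in the quotient topology and, for every set $X$, every $X$-indexed zero-convergent family in $\mathfrak A/\mathfrak H$ lifts to an $X$-indexed zero-convergent family in $\mathfrak A$. A right module over a topological ring $\mathfrak S$ is discrete if the annihilator of each of its elements is an open right ideal in $\mathfrak S$. A topological ring $\mathfrak S$ is topologically semisimple if the abelian category of discrete right $\mathfrak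 S$-modules is semisimple (equivalently, all short exact sequences in it split). *)

(* Defs.v *)
From HB Require Import structures.
From mathcomp Require Import all_boot all_algebra finmap generic_quotient.
From mathcomp Require Import boolp classical_sets functions cardinality fsbigop.
From mathcomp Require Import topology tvs.

Set Implicit Arguments.
Unset Strict Implicit.
Unset Printing Implicit Defensive.

Import GRing.Theory.
Local Open Scope classical_set_scope.
Local Open Scope ring_scope.

(* The zero ring is allowed, hence pzRingType. *)

HB.mixin Record TopologicalZmodule_isTopologicalPzRing R
    & GRing.PzRing R & Topological R := {
  mul_continuous : continuous (fun x : R * R => x.1 * x.2)
}.

#[short(type="topologicalPzRingType")]
HB.structure Definition TopologicalPzRing :=
  {R of GRing.PzRing R & TopologicalZmodule R
        & TopologicalZmodule_isTopologicalPzRing R}.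

Definition subgroup (A : zmodType) (H : set A) : Prop :=
  H 0 /\ forall x y, H x -> H y -> H (x - y).

Definition right_ideal (R : pzRingType) (I : set R) : Prop :=
  subgroup I /\ forall x r, I x -> I (x * r).

Definition maximal_right_ideal (R : pzRingType) (M : set R) : Prop :=
  [/\ right_ideal M, M <> setT &
      forall J, right_ideal J -> M `<=` J -> J = M \/ J = setT].

(* Completeness and separatedness with respect to a family B of subgroups:
   surjectivity, resp. injectivity, of A -> lim_(U in B) A / U.  An element of
   the limit is given by a choice c U of representatives of its components. *)

Definition complete_for (A : zmodType) (B : set (set A)) : Prop :=
  forall c : set A -> A,
    (forall U V, B U -> B V -> U `<=` V -> V (c U - c V)) ->
    exists a, forall U, B U -> U (a - c U).

Definition separated_for (A : zmodType) (B : set (set A)) : Prop :=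
  forall a, (forall U, B U -> U a) -> a = 0.

Definition open_subgroups (A : topologicalZmodType) : set (set A) :=
  [set U : set A | open U /\ subgroup U].

Definition open_right_ideals (R : topologicalPzRingType) : set (set R) :=
  [set I : set R | open I /\ right_ideal I].

Definition right_linear (R : topologicalPzRingType) : Prop :=
  forall U : set R, nbhs 0 U -> exists2 I, open_right_ideals I & I `<=` U.

Definition complete_separated_right_linear (R : topologicalPzRingType) : Prop :=
  [/\ right_linear R, separated_for (@open_right_ideals R) &
      complete_for (@open_right_ideals R)].

Definition zero_convergent (A : topologicalZmodType) (X : Type) (r : X -> A) :
    Prop :=
  forall U : set A, open_subgroups U -> finite_set [set x | ~ U (r x)].

(* s is the limit of the finite partial sums of r, along the directed set of
   finite subsets of X. *)
Definition is_sum (A : topologicalZmodType) (X : choiceType) (r : X -> A)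
    (s : A) : Prop :=
  forall U : set A, nbhs s U -> exists F0 : {fset X},
    forall F : {fset X}, (F0 `<=` F)%fset -> U (\sum_(x <- F) r x).

Definition invertible (S : pzRingType) (x : S) : Prop :=
  exists y, x * y = 1 /\ y * x = 1.

Definition local_ring (S : pzRingType) : Prop :=
  (1 : S) <> 0 /\ subgroup [set x : S | ~ invertible x].

(* The corner ring e R e, with unit e, as the set of all x with e x e = x. *)

Record corner (R : pzRingType) (e : R) (he : e * e = e) :=
  Corner { corner_val : R; _ : e * corner_val * e == corner_val }.

HB.instance Definition _ (R : pzRingType) (e : R) (he : e * e = e) :=
  [isSub for @corner_val R e he].
HB.instance Definition _ (R : pzRingType) (e : R) (he : e * e = e) :=
  [Choice of corner he by <:].

Section CornerRing.
Variables (R : pzRingType) (e : R) (he : e * e = e).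
Implicit Types x y z : corner he.

Let cornerE x : e * val x * e = val x. Proof. by apply/eqP/(valP x). Qed.

Let el x : e * val x = val x.
Proof. by rewrite -[in LHS]cornerE !mulrA he cornerE. Qed.

Let er x : val x * e = val x.
Proof. by rewrite -[in LHS]cornerE -!mulrA he mulrA cornerE. Qed.

Fact corner_zero_subproof : e * 0 * e == 0.
Proof. by rewrite mulr0 mul0r. Qed.
Fact corner_opp_subproof x : e * (- val x) * e == - val x.
Proof. by rewrite mulrN mulNr cornerE. Qed.
Fact corner_add_subproof x y : e * (val x + val y) * e == val x + val y.
Proof. by rewrite mulrDr mulrDl !cornerE. Qed.
Fact corner_one_subproof : e * e * e == e.
Proof. by rewrite !he. Qed.
Fact corner_mul_subproof x y : e * (val x * val y) * e == val x * val y.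
Proof. by rewrite mulrA el -mulrA er. Qed.

Definition corner_zero : corner he := Corner he corner_zero_subproof.
Definition corner_opp x : corner he := Corner he (corner_opp_subproof x).
Definition corner_add x y : corner he := Corner he (corner_add_subproof x y).
Definition corner_one : corner he := Corner he corner_one_subproof.
Definition corner_mul x y : corner he := Corner he (corner_mul_subproof x y).

Fact corner_addA : associative corner_add.
Proof. by move=> x y z; apply: val_inj; rewrite /= addrA. Qed.
Fact corner_addC : commutative corner_add.
Proof. by move=> x y; apply: val_inj; rewrite /= addrC. Qed.
Fact corner_add0 : left_id corner_zero corner_add.
Proof. by move=> x; apply: val_inj; rewrite /= add0r. Qed.
Fact corner_addN : left_inverse corner_zero corner_opp corner_add.
Proof. by move=> x; apply: val_inj; rewrite /= addNr. Qed.

HB.instance Definition _ := GRing.isZmodule.Build (corner he)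
  corner_addA corner_addC corner_add0 corner_addN.

Fact corner_mulA : associative corner_mul.
Proof. by move=> x y z; apply: val_inj; rewrite /= mulrA. Qed.
Fact corner_mul1l : left_id corner_one corner_mul.
Proof. by move=> x; apply: val_inj; rewrite /= el. Qed.
Fact corner_mul1r : right_id corner_one corner_mul.
Proof. by move=> x; apply: val_inj; rewrite /= er. Qed.
Fact corner_mulDl : left_distributive corner_mul +%R.
Proof. by move=> x y z; apply: val_inj; rewrite /= mulrDl. Qed.
Fact corner_mulDr : right_distributive corner_mul +%R.
Proof. by move=> x y z; apply: val_inj; rewrite /= mulrDr. Qed.

HB.instance Definition _ := GRing.Zmodule_isPzRing.Build (corner he)
  corner_mulA corner_mul1l corner_mul1r corner_mulDl corner_mulDr.

End CornerRing.

Definition topologically_semiperfect (R : topologicalPzRingType) : Prop :=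
  exists (Z : choiceType) (e : Z -> R) (he : forall z, e z * e z = e z),
    [/\ zero_convergent e,
        forall z w, z <> w -> e z * e w = 0,
        is_sum e 1 &
        forall z, local_ring (corner (he z))].

Notation topquot H := (quotient_topology {ideal_quot H}).

HB.instance Definition _ (A : topologicalZmodType) (H : zmodClosed A) :=
  GRing.isZmodule.Build (topquot H) (@Quotient.addqA A H)
    (@Quotient.addqC A H) (@Quotient.add0q A H) (@Quotient.addNq A H).

Section TopQuotient.
Variables (A : topologicalZmodType) (H : zmodClosed A).
Local Notation Q := (topquot H).
Local Notation pi := (\pi_Q%qT : A -> Q).

Lemma topquot_piB (x y : A) : pi (x - y) = pi x - pi y.
Proof. exact: (raddfB (\pi_({ideal_quot H})%qT)). Qed.

Lemma topquot_piD (x y : A) : pi (x + y) = pi x + pi y.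
Proof. exact: (raddfD (\pi_({ideal_quot H})%qT)). Qed.

Lemma topquot_eqP (x y : A) : pi x = pi y <-> x - y \in H.
Proof.
rewrite (Quotient.idealrBE H); split=> [xy|/eqP//].
by apply/eqP.
Qed.

Lemma continuous_addl (x : A) : continuous (+%R x).
Proof.
move=> y; apply: (@continuous_comp _ _ _ (fun y => (x, y))
  (fun z : A * A => z.1 + z.2)); last exact: add_continuous.
by apply: cvg_pair => /=; [exact: cvg_cst|exact: cvg_id].
Qed.

Lemma topquot_pi_open (U : set A) : open U -> open (pi @` U).
Proof.
move=> oU; rewrite /open /= /quotient_open.
rewrite (_ : _ @^-1` _ = \bigcup_(h in [set h | h \in H]) (+%R h @^-1` U)).
  apply: bigcup_open => h _; apply: open_comp => // x _; exact: continuous_addl.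
apply/seteqP; split=> [x [u Uu /topquot_eqP uxH]|x [h hH Uhx]] /=.
  by exists (u - x) => //=; rewrite subrK.
by exists (h + x) => //; apply/topquot_eqP; rewrite addrK.
Qed.

Lemma topquot_nbhs (a : A) (U : set A) : nbhs a U -> nbhs (pi a) (pi @` U).
Proof.
rewrite nbhsE => -[V [oV Va] VU].
rewrite nbhsE; exists (pi @` V); last exact: image_subset.
by split; [exact: topquot_pi_open|exists a].
Qed.

Lemma topquot_continuous2 (f : A * A -> A) (g : Q * Q -> Q) :
  continuous f -> (forall x y, g (pi x, pi y) = pi (f (x, y))) -> continuous g.
Proof.
move=> fc fg [p q]; rewrite -[p]reprK -[q]reprK.
set a := repr p; set b := repr q; move=> W; rewrite fg => Wab.
have /(fc (a, b)) [[U V] /= [Ua Vb] UVW] := pi_continuous Wab.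
exists (pi @` U, pi @` V) => /=; first by split; exact: topquot_nbhs.
by move=> [_ _] /= [[x Ux <-] [y Vy <-]]; rewrite fg; exact: (UVW (x, y)).
Qed.

Fact topquot_sub_continuous : continuous (fun x : Q * Q => x.1 - x.2).
Proof.
by apply: (topquot_continuous2 (@sub_continuous A)) => x y; rewrite topquot_piB.
Qed.

HB.instance Definition _ :=
  PreTopologicalNmodule_isTopologicalZmodule.Build Q topquot_sub_continuous.

End TopQuotient.

(* Open subgroups form a base at zero in A / H as soon as they do in A, so the
   completeness of A / H is expressed with its open subgroups. *)
Definition strongly_closed (A : topologicalZmodType) (H : zmodClosed A) : Prop :=
  [/\ closed [set x : A | x \in H],
      complete_for (@open_subgroups (topquot H)) &
      forall (X : Type) (q : X -> topquot H), zero_convergent q ->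
        exists2 r : X -> A, zero_convergent r &
          forall x, \pi_(topquot H)%qT (r x) = q x].

HB.mixin Record isTwoSidedIdeal (R : pzRingType) (S : R -> bool) := {
  idealMl : forall a x, x \in S -> a * x \in S;
  idealMr : forall a x, x \in S -> x * a \in S
}.

#[short(type="twoSidedIdeal")]
HB.structure Definition TwoSidedIdeal (R : pzRingType) :=
  {S of GRing.ZmodClosed R S & isTwoSidedIdeal R S}.

Section TopQuotientRing.
Variables (R : topologicalPzRingType) (I : twoSidedIdeal R).
Local Notation Q := (topquot I).
Local Notation pi := (\pi_Q%qT : R -> Q).

Definition topquot_one : Q := pi 1.
Definition topquot_mul (p q : Q) : Q := pi (repr p * repr q).

Lemma topquot_mulE x y : topquot_mul (pi x) (pi y) = pi (x * y).
Proof.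
rewrite /topquot_mul; set x' := repr _; set y' := repr _; apply/topquot_eqP.
have xI : x' - x \in I by apply/topquot_eqP; rewrite reprK.
have yI : y' - y \in I by apply/topquot_eqP; rewrite reprK.
rewrite -(subrK (x' * y) (x' * y')) -mulrBr -addrA -mulrBl.
by apply: rpredD; [exact: idealMl|exact: idealMr].
Qed.

Fact topquot_mulA : associative topquot_mul.
Proof.
elim/quotW=> x; elim/quotW=> y; elim/quotW=> z.
by rewrite (topquot_mulE y z) (topquot_mulE x y) !topquot_mulE mulrA.
Qed.
Fact topquot_mul1l : left_id topquot_one topquot_mul.
Proof. by elim/quotW=> x; rewrite topquot_mulE mul1r. Qed.
Fact topquot_mul1r : right_id topquot_one topquot_mul.
Proof. by elim/quotW=> x; rewrite topquot_mulE mulr1. Qed.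
Fact topquot_mulDl : left_distributive topquot_mul +%R.
Proof.
elim/quotW=> x; elim/quotW=> y; elim/quotW=> z.
rewrite -topquot_piD (topquot_mulE x z) (topquot_mulE y z) topquot_mulE.
by rewrite mulrDl topquot_piD.
Qed.
Fact topquot_mulDr : right_distributive topquot_mul +%R.
Proof.
elim/quotW=> x; elim/quotW=> y; elim/quotW=> z.
rewrite -topquot_piD (topquot_mulE x y) (topquot_mulE x z) topquot_mulE.
by rewrite mulrDr topquot_piD.
Qed.

HB.instance Definition _ := GRing.Zmodule_isPzRing.Build Q
  topquot_mulA topquot_mul1l topquot_mul1r topquot_mulDl topquot_mulDr.

Fact topquot_mul_continuous : continuous (fun x : Q * Q => x.1 * x.2).
Proof.
apply: (topquot_continuous2 (@mul_continuous R)) => x y /=.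
exact: topquot_mulE.
Qed.

HB.instance Definition _ :=
  TopologicalZmodule_isTopologicalPzRing.Build Q topquot_mul_continuous.

End TopQuotientRing.

Definition topJacobson (R : topologicalPzRingType) : {pred R} :=
  fun x => x \in \bigcap_(M in [set M : set R |
                                 open M /\ maximal_right_ideal M]) M.
Arguments topJacobson : clear implicits.

Section TopJacobson.
Variable R : topologicalPzRingType.
Implicit Types (x y : R) (M J : set R).

Lemma topJacobsonP x :
  reflect (forall M, open M -> maximal_right_ideal M -> M x)
          (x \in topJacobson R).
Proof.
apply: (iffP idP) => [/set_mem xJ M oM mM|xJ]; first exact: xJ.
by apply/mem_set => M [oM mM]; exact: xJ.
Qed.

Fact topJacobson_zmod_closed : zmod_closed (topJacobson R).
Proof.
split=> [|x y /topJacobsonP xJ /topJacobsonP yJ].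
  by apply/topJacobsonP => M _ [[[]]].
apply/topJacobsonP => M oM mM; have [[[_ MB] _] _ _] := mM.
by apply: MB; [exact: xJ|exact: yJ].
Qed.

HB.instance Definition _ :=
  GRing.isZmodClosed.Build R (topJacobson R) topJacobson_zmod_closed.

Lemma continuous_mull (a : R) : continuous ( *%R a).
Proof.
move=> y; apply: (@continuous_comp _ _ _ (fun y => (a, y))
  (fun z : R * R => z.1 * z.2)); last exact: mul_continuous.
by apply: cvg_pair => /=; [exact: cvg_cst|exact: cvg_id].
Qed.

Lemma subgroup_opp M x : subgroup M -> M x -> M (- x).
Proof. by move=> [M0 MB] Mx; rewrite -sub0r; exact: MB. Qed.

Lemma subgroup_add M x y : subgroup M -> M x -> M y -> M (x + y).
Proof.
by move=> MS Mx My; rewrite -[y]opprK; apply: MS.2 => //; exact: subgroup_opp.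
Qed.

Lemma preimage_maximal M (a : R) : maximal_right_ideal M ->
  let N := [set x | M (a * x)] in N = setT \/ maximal_right_ideal N.
Proof.
move=> [[Msub Mr] MT Mmax] N; have [M0 MB] := Msub.
have Nsub : subgroup N.
  by split=> [|x y Nx Ny]; rewrite /N/= ?mulr0// mulrBr; exact: MB.
have Nr : forall x r, N x -> N (x * r).
  by move=> x r Nx; rewrite /N/= mulrA; exact: Mr.
have [NT|NT] := pselect (N = setT); [by left|right; split=> // J].
move=> [Jsub Jr] NJ; have [J0 JB] := Jsub.
pose K := [set z | exists m j, [/\ M m, J j & z = m + a * j]].
have [||KM|KT] := Mmax K.
- split; last first.
    move=> _ r [m [j [Mm Jj ->]]]; exists (m * r), (j * r).
    by rewrite mulrDl mulrA; split=> //; [exact: Mr|exact: Jr].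
  split; first by exists 0, 0; rewrite mulr0 addr0.
  move=> _ _ [m [j [Mm Jj ->]]] [m' [j' [Mm' Jj' ->]]].
  exists (m - m'), (j - j'); split; [exact: MB|exact: JB|].
  by rewrite mulrBr opprD addrACA.
- by move=> m Mm; exists m, 0; rewrite mulr0 addr0.
- left; apply/seteqP; split=> // j Jj; rewrite /N /= -KM.
  by exists 0, j; rewrite add0r.
- right; apply/seteqP; split=> // x _.
  have [m [j [Mm Jj axE]]] : K (a * x) by rewrite KT.
  have Nxj : N (x - j) by rewrite /N/= mulrBr axE addrK.
  by rewrite -(subrK j x); apply: subgroup_add => //; exact: NJ.
Qed.

Fact topJacobson_idealMl (a x : R) :
  x \in topJacobson R -> a * x \in topJacobson R.
Proof.
move=> /topJacobsonP xJ; apply/topJacobsonP => M oM mM.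
have [NT|mN] := preimage_maximal a mM.
  by have : [set x | M (a * x)] x by rewrite NT.
apply: (xJ [set x | M (a * x)]) => //.
by apply: (open_comp (f := *%R a)) => // y _; exact: continuous_mull.
Qed.

Fact topJacobson_idealMr (a x : R) :
  x \in topJacobson R -> x * a \in topJacobson R.
Proof.
move=> /topJacobsonP xJ; apply/topJacobsonP => M oM mM.
by have [[_ Mr] _ _] := mM; apply: Mr; exact: xJ.
Qed.

HB.instance Definition _ := isTwoSidedIdeal.Build R (topJacobson R)
  topJacobson_idealMl topJacobson_idealMr.

End TopJacobson.

(* Right S-modules are left modules over the converse ring S^c: a *: v stands
   for v a. *)

Definition discrete_module (S : topologicalPzRingType) (V : lmodType S^c) :
    Prop :=
  forall v : V, open [set a : S | (a : S^c) *: v = 0].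

Definition submodule (K : pzRingType) (V : lmodType K) (W : set V) : Prop :=
  subgroup W /\ forall a v, W v -> W (a *: v).

Definition simple_submodule (K : pzRingType) (V : lmodType K) (W : set V) :
    Prop :=
  [/\ submodule W, W <> [set 0] &
      forall W', submodule W' -> W' `<=` W -> W' = [set 0] \/ W' = W].

Definition semisimple_module (K : pzRingType) (V : lmodType K) : Prop :=
  exists (I : choiceType) (W : I -> set V),
    (forall i, simple_submodule (W i)) /\
    forall v : V, exists! w : I -> V,
      [/\ forall i, W i (w i), finite_set [set i | w i <> 0] &
          v = \sum_(i \in [set: I]) w i].

(* An abelian category with coproducts is semisimple when each of its objects is
   a coproduct of simple objects.  Submodules and direct sums of discrete
   modules are discrete, so that simple objects and coproducts of discrete
   modules are the module-theoretic ones. *)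
Definition topologically_semisimple (S : topologicalPzRingType) : Prop :=
  forall V : lmodType S^c, discrete_module V -> semisimple_module V.

(* Main.v *)
Require Import Defs.
From mathcomp Require Import all_boot all_algebra topology tvs.
From mathcomp Require Import finmap.
From mathcomp Require Import boolp classical_sets cardinality fsbigop.

(** For a local idempotent e, the right module eR has a largest proper
    submodule, because the elements of eR generating eR are those that become
    invertible in the corner eRe after some right multiplication.  Its preimage
    under left multiplication by e is a maximal right ideal [row_maximal e],
    open because some open right ideal misses e.

    Completeness and the zero-convergence of (e_z) give R = prod_z e_z R
    ([exists_rows]): an open right ideal contains almost all e_z, hence almost
    all modules e_z R entirely, so that any choice of rows is summable.  A
    maximal open right ideal that misses e_z is, read in the row e_z R, the
    ideal [row_maximal (e z)]; hence the topological Jacobson radical H is the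
    product of the maximal submodules of the e_z R ([topJacobson_rowP]), and
    R / H is the product of the simple modules S_z = e_z R / rad(e_z R).

    The key to the topology is [exists_reduced_lift]: a class modulo H has a
    representative all of whose rows lying in the maximal submodule vanish.
    Since an element is small as soon as finitely many of its rows vanish, this
    shows that the topology of R / H is the product of the discrete topologies
    of the S_z ([coord_zero_base]), which yields completeness, and that lifts
    chosen this way form zero-convergent families.

    Finally, let v belong to a discrete R / H-module.  Each v e_z generates
    a quotient of S_z, so a zero or simple submodule, and v lies in any
    submodule containing all the v e_z, since the elements of R carrying v
    into that submodule form an open right ideal.  Thus the module is a sum of
    simple modules, and Zorn's lemma makes such a sum direct
    ([semisimple_of_span_simple]). *)

Set Implicit Arguments.
Unset Strict Implicit.
Unset Printing Implicit Defensive.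

Import GRing.Theory.
Local Open Scope classical_set_scope.
Local Open Scope ring_scope.

(** * Subgroups of abelian groups *)

Lemma subgroupN (A : zmodType) (U : set A) x : subgroup U -> U x -> U (- x).
Proof. by move=> [U0 UB] Ux; rewrite -sub0r; exact: UB. Qed.

Lemma subgroupD (A : zmodType) (U : set A) x y :
  subgroup U -> U x -> U y -> U (x + y).
Proof.
move=> sU Ux Uy; rewrite -[y]opprK; apply: sU.2 => //; exact: subgroupN.
Qed.

Lemma fsbig_subgroup (A : zmodType) (U : set A) (I : choiceType) (D : set I)
    (a : I -> A) :
  subgroup U -> (forall i, D i -> U (a i)) -> U (\sum_(i \in D) a i).
Proof.
move=> sU Ua; case: finite_supportP => [_|X XD _ _].
  by rewrite big_nil; exact: sU.1.
rewrite big_seq; apply: (big_ind U) => [|x y|i /XD]; first exact: sU.1.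
  exact: subgroupD.
exact: Ua.
Qed.

(** * Sums of simple modules *)

Section SemisimpleModules.
Variables (K : pzRingType) (V : lmodType K).
Implicit Types (U W : set V) (D E : set (set V)).

Definition span D : set V :=
  [set v | forall U, submodule U -> (forall W, D W -> W `<=` U) -> U v].

Lemma span_submodule D : submodule (span D).
Proof.
split; [split|].
- by move=> U [[]].
- by move=> x y xD yD U sU DU; apply: sU.1.2; [exact: (xD U)|exact: (yD U)].
- by move=> a v vD U sU DU; apply: sU.2; exact: (vD U).
Qed.

Lemma sub_span D W : D W -> W `<=` span D.
Proof. by move=> DW v Wv U _ /(_ W DW); apply. Qed.

Lemma spanS D E : D `<=` E -> span D `<=` span E.
Proof. by move=> DE v vD U sU EU; apply: vD => // W /DE; exact: EU. Qed.

Lemma submoduleI U W : submodule U -> submodule W -> submodule (U `&` W).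
Proof.
move=> sU sW; split; [split|].
- by split; [exact: sU.1.1|exact: sW.1.1].
- by move=> x y [Ux Wx] [Uy Wy]; split; [exact: sU.1.2|exact: sW.1.2].
- by move=> a v [Uv Wv]; split; [exact: sU.2|exact: sW.2].
Qed.

Lemma spanU1 D W v : submodule W -> span (W |` D) v ->
  exists2 w, W w & span D (v - w).
Proof.
move=> sW vWD; have sD := span_submodule D.
apply: (vWD [set u | exists2 w, W w & span D (u - w)]); [split; [split|]|].
- by exists 0; [exact: sW.1.1|rewrite subr0; exact: sD.1.1].
- move=> x y [w Ww xw] [w' Ww' yw']; exists (w - w'); first exact: sW.1.2.
  have -> : x - y - (w - w') = (x - w) - (y - w').
    by rewrite !opprB addrACA [RHS]addrACA [- y - w]addrC.
  exact: sD.1.2.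
- move=> a x [w Ww xw]; exists (a *: w); first exact: sW.2.
  by rewrite -scalerBr; exact: sD.2.
- move=> W' [->|DW'] x W'x.
    by exists x => //; rewrite subrr; exact: sD.1.1.
  by exists 0; [exact: sW.1.1|rewrite subr0; exact: sub_span DW' _ _].
Qed.

(** Independence is phrased through [span] rather than through finite families:
    it is then inherited by unions of chains with no bookkeeping of supports. *)
Definition independent D :=
  forall W v, D W -> W v -> span (D `\ W) v -> v = 0.

(** For A in the chain, the union of the spans of the B \ W, for B in the chain
    containing A, is a directed union, hence a submodule; so an element of the
    span of all modules other than W already lies in one of these spans. *)
Lemma independent_bigcup (F : set (set (set V))) :
  F `<=` independent -> total_on F subset ->
  independent (\bigcup_(D in F) D).
Proof.
move=> Find Ftot W v [A FA AW] Wv vspan.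
pose U := [set u | exists B, [/\ F B, A `<=` B & span (B `\ W) u]].
have [|W' [[B FB BW'] W'W] w W'w|B [FB AB]] := vspan U.
- split; [split|].
  + by exists A; split=> //; exact: (span_submodule _).1.1.
  + move=> x y [B [FB AB xB]] [C [FC AC yC]].
    have [BC|CB] := Ftot _ _ FB FC.
      exists C; split=> //; apply: (span_submodule _).1.2 => //.
      by apply: spanS xB; exact: setSD.
    exists B; split=> //; apply: (span_submodule _).1.2 => //.
    by apply: spanS yC; exact: setSD.
  + move=> a x [B [FB AB xB]]; exists B; split=> //.
    exact: (span_submodule _).2.
- have [AB|BA] := Ftot _ _ FA FB.
    by exists B; split=> //; apply: (@sub_span _ W').
  by exists A; split=> //; apply: (@sub_span _ W') => //; split=> //; exact: BA.
- by apply: (Find B FB) => //; exact: AB.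
Qed.

(** If v in W' is w + u with w in W and u in the span of the rest of D, then
    w = v - u lies in W and in the span of D, hence vanishes; the
    independence of D applies to what remains. *)
Lemma independentU1 D W : submodule W -> independent D ->
  W `&` span D `<=` [set 0] -> independent (W |` D).
Proof.
move=> sW Dind W0 W' v W'WD W'v vspan.
have [W'W|W'W] := pselect (W' = W).
  apply: W0; split; first by rewrite -W'W.
  apply: spanS vspan => X [[->|//] /= XW']; by rewrite W'W in XW'.
have DW' : D W' by case: W'WD.
have [w Ww vw] : exists2 w, W w & span (D `\ W') (v - w).
  apply: spanU1 => //; apply: spanS vspan => X [[->|DX] XW']; first by left.
  by right.
suff w0 : w = 0 by apply: (Dind W') => //; rewrite w0 subr0 in vw.
apply: W0; split=> //; rewrite -[w](subKr v).
apply: (span_submodule _).1.2; first exact: sub_span DW' _ _.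
by apply: spanS vw => X [].
Qed.

(** For a maximal independent set D of simple submodules, a simple W meets the
    span of D in 0 or in W; the first would allow adding W to D. *)
Lemma exists_independent_spanning :
  (forall v, span (@simple_submodule K V) v) ->
  exists D, [/\ D `<=` @simple_submodule K V, independent D &
                forall v, span D v].
Proof.
move=> Vspan.
pose P := [set D | D `<=` @simple_submodule K V /\ independent D].
have [|D [[Dsimple Dind] Dmax]] := @Zorn_bigcup _ P.
  move=> F FP Ftot; split; first by move=> W [A FA AW]; exact: (FP A FA).1.
  by apply: independent_bigcup => // A /FP[].
exists D; split=> // v; apply: Vspan; first exact: span_submodule.
move=> W [sW Wn0 Wsimple].
have [|W0|WW] := Wsimple (W `&` span D) (submoduleI sW (span_submodule D)).
- exact: subIsetl.
- have nDW : ~ D W.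
    move=> DW; apply: Wn0; rewrite -W0; apply/esym/setIidl; exact: sub_span.
  exfalso; apply: (Dmax (W |` D)).
    split; first by move=> ?; right.
    by move=> /(_ W) WD; apply/nDW/WD; left.
  split; first by move=> X [->|/Dsimple].
  by apply: independentU1 => //; rewrite W0.
- by rewrite -WW; exact: subIsetr.
Qed.

(** Sums of finitely supported families form a submodule, which gives the
    existence of decompositions; the difference d of two decompositions of v
    sums to 0, so d i is minus the sum of the other d j and vanishes by
    independence. *)
Lemma semisimple_of_span_simple :
  (forall v, span (@simple_submodule K V) v) -> semisimple_module V.
Proof.
move=> /exists_independent_spanning[D [Dsimple Dind Dspan]].
pose I : choiceType := D.
have ID (i : I) : D (val i) by exact: set_mem (valP i).
have subW (i : I) : submodule (val i) by case: (Dsimple _ (ID i)).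
pose family (w : I -> V) :=
  (forall i, val i (w i)) /\ finite_set [set i | w i <> 0].
(* A sum with infinite support is 0 by convention, so finiteness of the supports
   has to be carried along. *)
have fam_sub w w' : family w -> family w' ->
    family (fun i => w i - w' i) /\
    \sum_(i \in [set: I]) (w i - w' i) =
    \sum_(i \in [set: I]) w i - \sum_(i \in [set: I]) w' i.
  move=> [ww wf] [w'w w'f].
  have fU : finite_set ([set i | w i <> 0] `|` [set i | w' i <> 0]).
    by rewrite finite_setU.
  have sub : [set i | w i - w' i <> 0] `<=`
      [set i | w i <> 0] `|` [set i | w' i <> 0].
    move=> i /= wi; have [wi0|] := pselect (w i = 0); last by left.
    by right=> w'i0; apply: wi; rewrite wi0 w'i0 subrr.
  split; first split.
  - by move=> i; apply: (subW i).1.2.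
  - exact: sub_finite_set fU.
  set B := _ `|` _ in fU sub.
  have widen (u : I -> V) : (forall i, u i <> 0 -> B i) ->
      \sum_(i \in [set: I]) u i = \sum_(i <- fset_set B) u i.
    move=> uB; rewrite -fsbig_finite//; apply/esym/fsbig_widen => // i [_ nBi].
    by apply: contrapT => /uB.
  rewrite !widen; first by rewrite sumrB.
  + by move=> i ?; right.
  + by move=> i ?; left.
  + exact: sub.
exists I, val; split=> [i|v]; first exact: Dsimple (ID i).
have [w [wfam vE]] : exists w, family w /\ v = \sum_(i \in [set: I]) w i.
  apply: (Dspan v [set u | exists w, family w /\
      u = \sum_(i \in [set: I]) w i]) => [|W DW u Wu].
  - split; [split|].
    + exists (fun=> 0); split; last by rewrite fsbig1.
      split; first by move=> i; exact: (subW i).1.1.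
      by rewrite (_ : [set _ | _] = set0)//; apply/seteqP; split=> // i /=.
    + move=> x y [w [wfam ->]] [w' [w'fam ->]].
      by have [? <-] := fam_sub _ _ wfam w'fam; eexists; split; eauto.
    + move=> a x [w [[ww wf] ->]]; exists (fun i => a *: w i); split.
        split; first by move=> i; exact: (subW i).2.
        apply: sub_finite_set wf => i /= awi wi; apply: awi.
        by rewrite wi scaler0.
      pose B := [set i | w i <> 0].
      rewrite -(fsbig_widen B)//.
      rewrite -?(fsbig_widen B [set: I] (fun i => a *: w i))//.
      * by rewrite !fsbig_finite// scaler_sumr.
      * by move=> i [_ /contrapT /= ->]; rewrite scaler0.
      * by move=> i [_ /contrapT].
  - pose i : I := SigSub (mem_set DW).
    exists (fun j => if j == i then u else 0); split.
      split=> [j|]; last first.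
        by apply: (@sub_finite_set _ _ [set i]) => // j /=; case: eqP.
      by case: eqP => [->//|_]; exact: (subW j).1.1.
    rewrite -(fsbig_widen [set i])//; first by rewrite fsbig_set1 eqxx.
    by move=> j [_ /eqP /negPf /= ->].
exists w; split; first by case: wfam.
move=> w' [w'w w'f vE']; apply/funext => i; apply/eqP; rewrite -subr_eq0.
apply/eqP; have [[dW dfin]] := fam_sub _ _ wfam (conj w'w w'f).
rewrite -vE -vE' subrr; set d := fun i => w i - w' i => d0.
(* The index i is added to the support so that its term can be isolated. *)
pose B := i |` [set j | d j <> 0].
have fB : finite_set B by rewrite finite_setU; split.
apply: (Dind (val i)); [exact: ID|exact: dW|].
have -> : w i - w' i = 0 - \sum_(j \in B `\ i) d j.
  apply/eqP; rewrite sub0r -addr_eq0 -(fsbigD1 i B d)//; last by left.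
  apply/eqP; rewrite -[RHS]d0; apply: fsbig_widen => // j [_ nBj] /=.
  by apply: contrapT => dj; apply: nBj; right.
apply: (span_submodule _).1.2; first exact: (span_submodule _).1.1.
apply: fsbig_subgroup; first exact: (span_submodule _).1.
move=> j [_ ji]; apply: (@sub_span _ (val j)); last exact: dW.
by split=> // /val_inj.
Qed.

End SemisimpleModules.

(** * Linear topologies and completeness *)

(** Translates of a neighborhood of zero inside U cover U. *)
Lemma open_subgroupP (A : topologicalZmodType) (U : set A) :
  subgroup U -> nbhs (0 : A) U -> open U.
Proof.
move=> sU nU; rewrite openE => x Ux; rewrite /interior.
have : nbhs x (+%R (- x) @^-1` U).
  by apply: continuous_addl; rewrite addNr.
by apply: filterS => y /= Uy; rewrite -(addKr (- x) y) opprK; exact: subgroupD.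
Qed.

(** The complement of U is a union of cosets of U. *)
Lemma open_subgroup_closed (A : topologicalZmodType) (U : set A) :
  open U -> subgroup U -> closed U.
Proof.
move=> oU sU; rewrite -[U]setCK closedC openE => x nUx; rewrite /interior.
have : nbhs x (+%R (- x) @^-1` U).
  apply: continuous_addl; rewrite addNr.
  by apply: open_nbhs_nbhs; split=> //; exact: sU.1.
apply: filterS => y /= Uy Uy'; apply: nUx.
by rewrite -(subKr y x) [y - x]addrC; exact: sU.2.
Qed.

(** For V in the smaller family and inside U, the components c V and c U agree
    modulo U, so an element with the right components on the smaller family has
    the right components everywhere. *)
Lemma complete_for_base (A : zmodType) (B B' : set (set A)) :
  B' `<=` B -> (forall U, B U -> exists2 V, B' V & V `<=` U) ->
  (forall U, B U -> subgroup U) -> complete_for B' -> complete_for B.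
Proof.
move=> B'B Bbase Bsub B'c c cc.
have [|a aP] := B'c c; first by move=> U V /B'B BU /B'B; exact: cc.
exists a => U BU; have [V B'V VU] := Bbase U BU.
have -> : a - c U = (a - c V) + (c V - c U) by rewrite addrA subrK.
apply: subgroupD; [exact: Bsub|by apply: VU; exact: aP|].
by apply: cc => //; exact: B'B.
Qed.

Lemma topquot_pi0 (A : topologicalZmodType) (H : zmodClosed A) :
  \pi_(topquot H)%qT (0 : A) = 0.
Proof. by rewrite -(subrr (0 : A)) topquot_piB subrr. Qed.

(** * Right ideals and local idempotents *)

(** When e is an idempotent with local corner, these are the elements r such
    that er lies in the largest proper submodule of eR. *)
Definition row_maximal (R : pzRingType) (e : R) : set R :=
  [set r | forall t, e * r * t <> e].

Lemma row_maximalPn (R : pzRingType) (a x : R) :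
  ~ row_maximal a x -> exists t, a * x * t = a.
Proof.
by move=> nN; apply: contrapT => nt; apply: nN => t axt; apply: nt; exists t.
Qed.

Lemma row_maximal_congr (R : pzRingType) (a x y : R) :
  a * x = a * y -> row_maximal a x -> row_maximal a y.
Proof. by rewrite /row_maximal /= => ->. Qed.

(** If e(x - y)t = e, then exte and eyte are elements of the corner whose
    difference is 1, so one of them is invertible there, and multiplying by its
    inverse recovers e from x or from y. *)
Lemma row_maximal_right_ideal (R : pzRingType) (e : R) (he : e * e = e) :
  local_ring (corner he) -> right_ideal (row_maximal e).
Proof.
move=> [n10 [_ NB]].
have cornerP y : e * (e * y * e) * e == e * y * e.
  by rewrite !mulrA he -mulrA he.
pose c y : corner he := Corner he (cornerP y).
have row_inv x t : invertible (c (x * t)) -> ~ row_maximal e x.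
  move=> [a' [/(congr1 val) /= aa' _]] /(_ (t * e * val a')); apply.
  by rewrite -[RHS]aa' !mulrA.
have e0 : e <> 0 by move=> e0; apply: n10; apply: val_inj; rewrite /= e0.
split; last first.
  by move=> x r Nx t; rewrite mulrA -mulrA; exact: Nx.
split=> [t|x y Nx Ny t xyt]; first by rewrite mulr0 mul0r => /esym.
have c1 : c (x * t) - c (y * t) = 1.
  apply: val_inj => /=; rewrite -mulrBl -mulrBr -mulrBl mulrA xyt.
  by rewrite he.
have [/row_inv//|nx] := pselect (invertible (c (x * t))).
have [/row_inv//|ny] := pselect (invertible (c (y * t))).
have := NB _ _ nx ny; rewrite c1; apply.
by exists 1; rewrite !mulr1.
Qed.

(** The submodule of eR cut out by a right ideal J missing e lies below the
    maximal one; this is what compares arbitrary right ideals with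
    [row_maximal e]. *)
Lemma sub_row_maximal (R : pzRingType) (e x : R) (J : set R) :
  right_ideal J -> ~ J e -> J (e * x) -> row_maximal e x.
Proof. by move=> [_ Jr] nJe Jex t ext; apply: nJe; rewrite -ext; exact: Jr. Qed.

(** A right ideal J above [row_maximal e] contains 1 - e, which e kills.  If J
    also contains x with ext = e, then e = xt - (1 - e)xt lies in J as well. *)
Lemma row_maximal_maximal (R : pzRingType) (e : R) (he : e * e = e) :
  local_ring (corner he) -> maximal_right_ideal (row_maximal e).
Proof.
move=> eloc; have Nid := row_maximal_right_ideal eloc; split=> //.
  move=> NT; have : row_maximal e e by rewrite NT.
  by move/(_ e); rewrite !he.
move=> J [[J0 JB] Jr] NJ.
have [JN|JN] := pselect (J `<=` row_maximal e); first by left; apply/seteqP.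
right; have [x Jx [t ext]] : exists2 x, J x & exists t, e * x * t = e.
  apply: contrapT => nx; apply: JN => x Jx t ext.
  by apply: nx; exists x => //; exists t.
have J1e : J (1 - e).
  apply: NJ => u; rewrite mulrBr mulr1 he subrr mul0r => e0.
  by have /(_ 1) := Nid.1.1; rewrite mulr0 mul0r.
apply/seteqP; split=> // y _.
have Je : J e.
  have -> : e = x * t - (1 - e) * (x * t).
    by rewrite mulrBl mul1r opprB addrC subrK mulrA ext.
  by apply: JB; exact: Jr.
rewrite -[y]mul1r -(subrK e 1); apply: Jr.
by apply: subgroupD.
Qed.

(** * The topological Jacobson radical of a semiperfect ring *)

Section SemiperfectRing.
Variable R : topologicalPzRingType.
Hypothesis R_topring : complete_separated_right_linear R.
Variables (Z : choiceType) (e : Z -> R) (he : forall z, e z * e z = e z).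
Hypotheses (e_cvg : zero_convergent e)
  (e_orth : forall z w, z <> w -> e z * e w = 0) (e_sum : is_sum e 1)
  (e_local : forall z, local_ring (corner (he z))).

Local Notation H := (topJacobson R).
Local Notation Q := (topquot H).
Local Notation pi := (\pi_Q%qT : R -> Q).
Local Notation N z := (row_maximal (e z)).

Let N_right_ideal z : right_ideal (N z).
Proof. exact: row_maximal_right_ideal. Qed.

Let e_neq0 z : e z <> 0.
Proof. by move=> ez; apply: (e_local z).1; apply: val_inj; rewrite /= ez. Qed.

Lemma row_maximal_open z : open (N z).
Proof.
have [_ sep _] := R_topring.
have [I [oI rI] nIe] : exists2 I, open_right_ideals I & ~ I (e z).
  apply: contrapT => nI; apply: (@e_neq0 z); apply: sep => I oI.
  by apply: contrapT => nIe; apply: nI; exists I.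
apply: open_subgroupP; first exact: (N_right_ideal z).1.
have : nbhs (0 : R) ( *%R (e z) @^-1` I).
  apply: continuous_mull; rewrite mulr0; apply: open_nbhs_nbhs; split=> //.
  exact: rI.1.1.
by apply: filterS => x; exact: sub_row_maximal.
Qed.

(** An element is the sum of its rows; a finite partial sum of the e_z is close
    enough to 1, and only finite sums of rows are then needed. *)
Lemma mem_open_right_ideal (I : set R) x :
  open I -> right_ideal I -> (forall z, I (e z * x)) -> I x.
Proof.
move=> oI [sI rI] Ie.
have [F0 /(_ F0 (fsubset_refl _)) /= IF] : exists F0 : {fset Z},
    forall F : {fset Z}, (F0 `<=` F)%fset ->
      (+%R (- 1) @^-1` I) (\sum_(z <- F) e z).
  apply: e_sum; apply: continuous_addl; rewrite addNr.
  by apply: open_nbhs_nbhs; split=> //; exact: sI.1.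
have -> : x = \sum_(z <- F0) e z * x - (-1 + \sum_(z <- F0) e z) * x.
  by rewrite mulrDl mulN1r mulr_suml opprD opprK addrCA subrr addr0.
apply: sI.2; last exact: rI.
by apply: (big_ind I) => // [|? ?]; [exact: sI.1|exact: subgroupD].
Qed.

(** Modulo an open right ideal I, the sum of the e_z a_z reduces to the finitely
    many z with e_z outside I.  These finite sums are compatible, so
    completeness provides r. *)
Lemma exists_rows (a : Z -> R) : exists r, forall z, e z * r = e z * a z.
Proof.
have [_ sep comp] := R_topring.
pose F (I : set R) := [set z | ~ I (e z)].
have finF I : open_right_ideals I -> finite_set (F I).
  by move=> [oI [sI _]]; exact: e_cvg.
pose c (I : set R) := \sum_(z \in F I) e z * a z.
have [|r rP] := comp c.
  move=> I J oI oJ IJ; have [_ [sJ rJ]] := oJ.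
  rewrite /c (fsbigID (F J))//; last exact: finF.
  have -> : F I `&` F J = F J by apply/setIidr => z nJ /IJ.
  rewrite /= addrC addrK; apply: fsbig_subgroup => // z [_ /contrapT Je].
  exact: rJ.
exists r => w; apply/eqP; rewrite -subr_eq0; apply/eqP; apply: sep => I oI.
have [opI [sI rI]] := oI.
(* To control e_w (r - c) modulo I, the difference is taken modulo K. *)
pose K := [set x | I (e w * x)].
have oK : open_right_ideals K.
  split; first by apply: open_comp opI => x _; exact: continuous_mull.
  split; last by move=> x y; rewrite /K /= mulrA; exact: rI.
  split=> [|x y Kx Ky]; rewrite /K /= ?mulr0 ?mulrBr; first exact: sI.1.
  exact: sI.2.
(* The finite sum c K is a sum of rows, each killed by e_w except the w-th. *)
have ker : subgroup [set x | e w * x = 0].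
  by split=> [|x y /= x0 y0]; rewrite /= ?mulr0 // mulrBr x0 y0 subrr.
have -> : e w * r - e w * a w = e w * (r - c K) + (e w * c K - e w * a w).
  by rewrite mulrBr addrA subrK.
apply: subgroupD => //; first exact: rP oK.
have [Kw|Kw] := pselect (K (e w)).
  have -> : e w * c K = 0.
    apply: (fsbig_subgroup ker) => z nKz /=; rewrite mulrA e_orth ?mul0r//.
    by move=> wz; apply: nKz; rewrite -wz.
  rewrite sub0r; apply: subgroupN => //; apply: rI.
  by move: Kw; rewrite /K /= he.
have -> : e w * c K = e w * a w; last by rewrite subrr; exact: sI.1.
rewrite /c (fsbigD1 w)//; last exact: finF.
rewrite mulrDr mulrA he -[RHS]addr0; congr (_ + _).
apply: (fsbig_subgroup ker) => z [_ zw] /=; rewrite mulrA e_orth ?mul0r//.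
by move=> wz; apply: zw.
Qed.

(** If an open maximal M misses r, it misses some row e_w r, and then also e_w.
    The preimage of M under left multiplication by e_w is maximal and contained
    in [row_maximal (e w)], so the two are equal, and r is not in the latter. *)
Lemma topJacobson_rowP r : r \in H <-> forall z, N z r.
Proof.
split=> [/topJacobsonP rH z|rN].
  by apply: rH; [exact: row_maximal_open|exact: row_maximal_maximal].
apply/topJacobsonP => M oM mM; have [rM _ _] := mM.
apply: mem_open_right_ideal => // w; apply: contrapT => nMer.
have nMe : ~ M (e w) by move=> Me; apply: nMer; exact: rM.2.
have [MT|[_ _ Mmax]] := preimage_maximal (e w) mM.
  have : [set x | M (e w * x)] 1 by rewrite MT.
  by rewrite /= mulr1.
have [x|NM|NT] := Mmax _ (N_right_ideal w).
- exact: sub_row_maximal.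
- by apply: nMer; have : N w r := rN w; rewrite NM.
- by have [_ /(_ NT)] := row_maximal_maximal (e_local w).
Qed.

(** Replace by zero every row of r that lies in the maximal submodule; this only
    changes r by an element of the radical. *)
Lemma exists_reduced_lift r :
  exists2 r', pi r' = pi r & forall z, N z r -> e z * r' = 0.
Proof.
have [r' r'E] := exists_rows (fun z => if `[< N z r >] then 0 else r).
exists r'; last by move=> z Nr; rewrite r'E asboolT// mulr0.
apply/topquot_eqP/topJacobson_rowP => z.
have [N0 NB] := (N_right_ideal z).1.
have [Nr|nNr] := pselect (N z r).
  apply: (@row_maximal_congr _ _ (0 - r)); last exact: NB.
  by rewrite !mulrBr r'E asboolT.
apply: (@row_maximal_congr _ _ 0) => //.
by rewrite mulrBr r'E asboolF// mulr0 subrr.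
Qed.

Lemma row_maximal_pi z x y : pi x = pi y -> N z x -> N z y.
Proof.
move=> /esym/topquot_eqP/topJacobson_rowP/(_ z) Nyx Nx.
by rewrite -(subrK x y); exact: (subgroupD (N_right_ideal z).1).
Qed.

(** * The topology of the quotient *)

(** The kernel of the projection of R / H, seen as the product of the simple
    modules e_z R / rad(e_z R), onto its coordinates in F. *)
Definition coord_zero (F : set Z) : set Q :=
  pi @` [set r | forall z, F z -> N z r].

Lemma coord_zeroP F r : coord_zero F (pi r) <-> forall z, F z -> N z r.
Proof.
split=> [[x xF xr] z Fz|rF]; last by exists r.
by apply: row_maximal_pi xr _; exact: xF.
Qed.

Lemma coord_zero_open_right_ideal F :
  finite_set F -> open_right_ideals (coord_zero F).
Proof.
move=> finF; split.
  apply: topquot_pi_open; rewrite (_ : mkset _ = \bigcap_(z in F) N z)//.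
  rewrite -bigsetI_fset_set//.
  apply: (big_ind open); [exact: openT|exact: openI|].
  by move=> z _; exact: row_maximal_open.
split; [split|].
- exists 0; first by move=> z _; exact: (N_right_ideal z).1.1.
  exact: topquot_pi0.
- move=> _ _ [x xF <-] [y yF <-]; exists (x - y); last exact: topquot_piB.
  by move=> z Fz; apply: (N_right_ideal z).1.2; [exact: xF|exact: yF].
- move=> _ + [x xF <-]; elim/quotW => y; exists (x * y).
    by move=> z Fz; apply: (N_right_ideal z).2; exact: xF.
  by rewrite -topquot_mulE.
Qed.

(** Given an open right ideal I over U, take for F the finite set of z with e_z
    outside I: a reduced lift of a class in [coord_zero F] has zero rows at F
    and all its other rows in I, so it belongs to I. *)
Lemma coord_zero_base (U : set Q) :
  nbhs (0 : Q) U -> exists2 F, finite_set F & coord_zero F `<=` U.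
Proof.
move=> U0; have [lin _ _] := R_topring.
have [I [oI rI] IU] : exists2 I, open_right_ideals I & I `<=` pi @^-1` U.
  by apply: lin; apply: pi_continuous; rewrite topquot_pi0.
exists [set z | ~ I (e z)]; first by apply: e_cvg; split=> //; exact: rI.1.
move=> _ [r rF <-]; have [r' <- r'0] := exists_reduced_lift r.
apply: IU; apply: mem_open_right_ideal => // z.
have [Ie|nIe] := pselect (I (e z)); first exact: rI.2.
by rewrite r'0; [exact: rI.1.1|exact: rF].
Qed.

(** The element sought is prescribed coordinate by coordinate, the z-th
    coordinate being that of the component of c at [coord_zero [set z]].  The
    lemma is stated for a variable family B because completeness is needed both
    for the open subgroups and for the open right ideals of the quotient. *)
Lemma quotient_complete (B : set (set Q)) :
  (forall F, finite_set F -> B (coord_zero F)) ->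
  (forall U, B U -> open U /\ subgroup U) -> complete_for B.
Proof.
move=> Bc Bsub.
apply: (@complete_for_base _ _ [set coord_zero F | F in finite_set]).
- by move=> _ [F finF <-]; exact: Bc.
- move=> U /Bsub[oU sU].
  have [|F finF FU] := @coord_zero_base U.
    by apply: open_nbhs_nbhs; split=> //; exact: sU.1.
  by exists (coord_zero F) => //; exists F.
- by move=> U /Bsub[].
move=> c cc.
have [a aE] := exists_rows (fun z => repr (c (coord_zero [set z]))).
exists (pi a) => _ [F finF <-].
rewrite -[c _]reprK -topquot_piB; apply/coord_zeroP => z Fz.
set b := repr _.
have zb : N z (b - repr (c (coord_zero [set z]))).
  have : coord_zero [set z] (c (coord_zero F) - c (coord_zero [set z])).
    apply: cc; [by exists F|by exists [set z]|].
    by move=> _ [r rF <-]; apply/coord_zeroP => _ ->; exact: rF.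
  rewrite -[c (coord_zero F)]reprK -[c (coord_zero [set z])]reprK -topquot_piB.
  by move=> /coord_zeroP; rewrite !reprK; exact.
apply: (@row_maximal_congr _ _ (0 - (b - repr (c (coord_zero [set z]))))).
  by rewrite sub0r opprB !mulrBr aE.
have [N0 NB] := (N_right_ideal z).1; exact: NB.
Qed.

(** Reduced lifts of a zero-convergent family are zero-convergent: modulo an
    open right ideal only finitely many rows matter, and each of these rows
    vanishes in almost all the lifts. *)
Lemma topJacobson_strongly_closed : strongly_closed (topJacobson R).
Proof.
have [lin _ _] := R_topring.
split.
- rewrite (_ : [set x | _] = \bigcap_z N z); last first.
    by apply/seteqP; split=> x /=; [move=> /topJacobson_rowP xN z _|
      move=> xN; apply/topJacobson_rowP => z]; exact: xN.
  apply: closed_bigI => z _; apply: open_subgroup_closed.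
    exact: row_maximal_open.
  exact: (N_right_ideal z).1.
- apply: quotient_complete => // F /coord_zero_open_right_ideal[oF [sF _]].
  by split.
- move=> X q q0.
  have /choice[r rP] x : exists r, pi r = q x /\
      forall z, coord_zero [set z] (q x) -> e z * r = 0.
    have [r rq r0] := exists_reduced_lift (repr (q x)).
    exists r; split; first by rewrite rq reprK.
    by move=> z; rewrite -{1}[q x]reprK => /coord_zeroP/(_ z erefl)/r0.
  exists r => [U [oU sU]|x]; last by case: (rP x).
  have [|I [oI rI] IU] := lin U.
    by apply: open_nbhs_nbhs; split=> //; exact: sU.1.
  pose F := [set z | ~ I (e z)].
  have finF : finite_set F by apply: e_cvg; split=> //; exact: rI.1.
  apply: (@sub_finite_set _ _
    (\bigcup_(z in F) [set x | ~ coord_zero [set z] (q x)])).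
    move=> x /= nUx; apply: contrapT => nx; apply: nUx; apply: IU.
    apply: mem_open_right_ideal => // z.
    have [Ie|nIe] := pselect (I (e z)); first exact: rI.2.
    rewrite (rP x).2; first exact: rI.1.1.
    by apply: contrapT => nq; apply: nx; exists z.
  apply: bigcup_finite => // z _; apply: q0.
  by have [oz [sz _]] := coord_zero_open_right_ideal (finite_set1 z).
Qed.

Lemma quotient_topring : complete_separated_right_linear Q.
Proof.
split.
- move=> U /coord_zero_base[F finF FU]; exists (coord_zero F) => //.
  exact: coord_zero_open_right_ideal.
- elim/quotW => r rI; rewrite -(topquot_pi0 H).
  apply/topquot_eqP; rewrite subr0; apply/topJacobson_rowP => z.
  apply: ((coord_zeroP [set z] r).1 _ z erefl); apply: rI.
  exact: coord_zero_open_right_ideal.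
- apply: quotient_complete; first exact: coord_zero_open_right_ideal.
  by move=> U [oU [sU _]].
Qed.

(** The rows other than the z-th one of e_z r vanish. *)
Lemma topJacobson_row z r : N z r -> e z * r \in H.
Proof.
move=> Nr; apply/topJacobson_rowP => w; have [<-|wz] := pselect (z = w).
  by apply: row_maximal_congr Nr; rewrite mulrA he.
apply: (@row_maximal_congr _ _ 0); last exact: (N_right_ideal w).1.1.
by rewrite mulrA e_orth ?mul0r ?mulr0// => /esym.
Qed.

(** * Discrete modules over the quotient *)

Section DiscreteModule.
Variable V : lmodType Q^c.
Implicit Type v : V.

Local Notation "v *> r" := ((pi r : Q^c) *: v) (at level 40).

Lemma actM v r s : (v *> r) *> s = v *> (r * s).
Proof. by rewrite scalerA; congr (_ *: _); exact: topquot_mulE. Qed.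

Lemma act0 v : v *> 0 = 0.
Proof. by rewrite topquot_pi0 scale0r. Qed.

Lemma actB v r s : v *> (r - s) = v *> r - v *> s.
Proof. by rewrite topquot_piB scalerBl. Qed.

(** If v e_z r is nonzero, then e_z r is outside the radical, hence r is outside
    [row_maximal (e z)] and some t takes v e_z r back to v e_z. *)
Lemma simple_row_submodule v z :
  v *> e z <> 0 -> simple_submodule [set v *> (e z * r) | r in [set: R]].
Proof.
move=> vez; split.
- split; [split|].
  + by exists 0 => //; rewrite mulr0 act0.
  + by move=> _ _ [r _ <-] [s _ <-]; exists (r - s) => //; rewrite mulrBr actB.
  + move=> a _ [r _ <-]; rewrite -[a]reprK actM -mulrA.
    by exists (r * repr a).
- move=> W0; apply: vez.
  have : [set v *> (e z * r) | r in [set: R]] (v *> e z).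
    by exists 1; rewrite ?mulr1.
  by rewrite W0.
- move=> W' [sW' W'Z] W'W.
  have [W'0|] := pselect (W' `<=` [set 0]).
    by left; apply/seteqP; split=> // _ ->; exact: sW'.1.
  move=> nW'0; right; apply/seteqP; split=> // _ [s _ <-].
  have [x W'x xn0] : exists2 x, W' x & x <> 0.
    by apply: contrapT => nx; apply: nW'0 => x W'x; apply: contrapT => xn0;
      apply: nx; exists x.
  have [r _ xE] := W'W _ W'x.
  have [t ert] : exists t, e z * r * t = e z.
    apply: row_maximalPn => /topJacobson_row erH; apply: xn0; rewrite -xE.
    rewrite (_ : pi (e z * r) = 0) ?scale0r// -(topquot_pi0 H).
    by apply/topquot_eqP; rewrite subr0.
  have -> : v *> (e z * s) = x *> (t * s) by rewrite -xE actM mulrA ert.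
  exact: W'Z.
Qed.

(** The elements r with v r in a submodule U form a right ideal, open since it
    contains the annihilator of v; so it contains 1 as soon as it contains every
    e_z. *)
Lemma discrete_semisimple : discrete_module V -> semisimple_module V.
Proof.
move=> Vdisc; apply: semisimple_of_span_simple => v U sU simpleU.
have sK : subgroup [set r | U (v *> r)].
  split=> [|r s Ur Us] /=; rewrite ?act0 ?actB; first exact: sU.1.1.
  exact: sU.1.2.
have -> : v = v *> 1 by rewrite (scale1r v).
apply: (@mem_open_right_ideal [set r | U (v *> r)]).
- apply: open_subgroupP => //.
  have : nbhs (0 : R) (pi @^-1` [set a : Q | (a : Q^c) *: v = 0]).
    apply: pi_continuous; apply: open_nbhs_nbhs; split; first exact: Vdisc.
    by rewrite /= act0.
  by apply: filterS => r /= ->; exact: sU.1.1.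
- by split=> // r s Ur; rewrite /= -actM; exact: sU.2.
- move=> z /=; rewrite mulr1.
  have [->|vez] := pselect (v *> e z = 0); first exact: sU.1.1.
  apply: (simpleU _ (simple_row_submodule vez)).
  by exists 1; rewrite ?mulr1.
Qed.

End DiscreteModule.

End SemiperfectRing.

Theorem theorem6p4 (R : topologicalPzRingType)
    (R_topring : complete_separated_right_linear R)
    (R_semiperfect : topologically_semiperfect R) :
  strongly_closed (topJacobson R) /\
  (complete_separated_right_linear (topquot (topJacobson R)) /\
   topologically_semisimple (topquot (topJacobson R))).
Proof.
have [Z [e [he [e_cvg e_orth e_sum e_local]]]] := R_semiperfect.
split; first exact: (@topJacobson_strongly_closed R R_topring Z e he).
split; first exact: (@quotient_topring R R_topring Z e he).
by move=> V; exact: (@discrete_semisimple R R_topring Z e he).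
Qed.
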